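(* Let $n,m\ge1$. When $b\geq\max\{3,m,n\}$, $$\mathfrak{i}^{\mathrm{char}}_{n,m}(b)\leq\mathcal{G}^{\omega^{\omega^m\cdot 2n+\omega}+\omega^{\omega^m\cdot 2n+1}+\omega^{\omega+1}+\omega^\omega\cdot 2+\omega^2+\omega\cdot 2}(b).$$
   Context: **Ordinal iteration.** For an ordinal $0<\alpha<\epsilon_0$ with Cantor normal form $\alpha=\sum_{\beta\in I}\omega^\beta c_\beta$ ($I$ a finite set of ordinals, $c_\beta$ positive integers), write $\min\alpha=\min I$. For $x\in\mathbb{N}$ define $\alpha[x]<\alpha$ recursively: $\alpha[x]=\alpha-1$ if $\min\alpha=0$, and otherwise $\alpha[x]=\sum_{\beta\in I\setminus\{\min\alpha\}}\omega^\beta c_\beta+\omega^{\min\alpha}(c_{\min\alpha}-1)+\omega^{(\min\alpha)[x]}x$. For $g:\mathbb{N}\to\mathbb{N}$, $g^0(b)=b$ and $g^\alpha(b)=g^{\alpha[b]}(g(b))$ for $\alpha>0$. $\mathcal{G}(b)=b+1$. **Derivatives.** With $m$ commuting derivations $\delta_1,\ldots,\delta_m$ and $n$ differential indeterminates $X_1,\ldots,X_n$, derivatives are the formal expressions $\theta X_i$ with $\theta\in\Theta=\{\delta_1^{k_1}\cdots\delta_m^{k_m}\}$, ordered by: $\delta_1^{k_1}\cdots\delta_m^{k_m}X_r<\delta_1^{l_1}\cdots\delta_m^{l_m}X_s$ iff $(\sum_i k_i,k_1,\ldots,k_m,r)$ is lexicographically smaller than $(\sum_i l_i,l_1,\ldots,l_m,s)$;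 $Z_1<Z_2<\cdots$ lists all derivatives in increasing order. **Bounding functions.** Superscripts $i$ on unary functions denote iteration. - $\mathfrak{d}_r(b)=(2b)^{2^r}$; $\mathfrak{e}(r,b)=2^{(b+\mathfrak{d}_{r-1}(b))^{r-1}+1}b+b+\mathfrak{d}_{r-1}(b)$; $\zeta_0(r,d)=\binom{r+\mathfrak{d}_r(d)}{r}$; $\zeta_1(r,d,b)=(\binom{b+r}{r}+2)\zeta_0(r,d)$; $\zeta_2(r,d,b)=(\zeta_1(r,d,b)+1)^{2^{\zeta_1(r,d,b)}-1}$. - $\mathfrak{p}_1(d)=d$, and for $r\ge2$, $\upsilon(r,d)=\zeta_1(r-1,\mathfrak{p}_{r-1}(d),d)\zeta_2(r-1,\mathfrak{p}_{r-1}(d),d)$ and $\mathfrak{p}_r(d)=\max\{2\binom{\upsilon(r,d)+r}{r}\upsilon(r,d),\mathfrak{e}(r-1,d)\}$. - For $\mathbf{E}:\mathbb{N}\to\mathbb{N}$ and a finite multiset $\tau$ of naturals: $\tau_{\langle k,i,\mathbf{E}\rangle}$ removes one copy of $k$ from $\tau$ and, if $k>0$, adds $k(\mathbf{E}(i)-1)$ copies of $k-1$; $\mathfrak{m}_{\emptyset,\mathbf{E}}(i)=0$, $\mathfrak{m}_{\tau,\mathbf{E}}(i)=1+\mathfrak{m}_{\tau_{\langle\min\tau,i,\mathbf{E}\rangle},\mathbf{E}}(i+1)$ for $\tau\neq\emptyset$; $\mathfrak{m}^*(\mathbf{D},r)=\mathfrak{m}_{\{r\},\mathbf{D}+1}(0)+1$,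 with $(\mathbf{D}+1)(i)=\mathbf{D}(i)+1$. - For $\mathbf{F}:\mathbb{N}\to\mathbb{N}$: $\mathbf{F}_x(b)=\mathbf{F}(\mathfrak{p}_x(b))$; $\mathfrak{u}_{\mathbf{F}}(x)=\mathbf{F}_x^{M}(x)$ with $M=\mathfrak{m}^*(i\mapsto\mathbf{F}_x^i(x),x)$; $\mathfrak{u}^+_{\mathbf{F}}(b)=\max\{\mathfrak{u}_{\mathbf{F}}(b),\mathfrak{d}_{b+1}(2b\binom{2b}{b}+1)\}$; and, with $u=\mathfrak{u}^+_{\mathbf{F}}(b)$ and $N=\mathfrak{d}_u(u)+u$, $\mathfrak{f}(\mathbf{F},b)=\mathfrak{d}_u(\binom{N+b}{b}u)+N$. - $\mathfrak{g}(b,d)=d(1+b)^d$. - $\mathfrak{z}^0(d,b)=d$ and, with $G=\mathfrak{g}(b+d-1,\max\{b+d-1,2b\})$, $\mathfrak{z}^{k+1}(d,b)=\mathfrak{z}^k\big(\mathfrak{d}_{b+d}((G+d+1)\binom{2b}{b}2b+d)+G+d+1,\ b\big)$. - A bad leader sequence is a finite sequence of derivatives $\langle u_1,\ldots,u_k\rangle$ with $u_1<\cdots<u_k$ and no $i<j$, $\theta\in\Theta$ with $\theta u_i=u_j$; there is no infinite one. Identify the derivative $Z_u$ with the number $u\ge1$ (so $u=0$ is not a derivative). For a finite sequence $\gamma$ of pairs $(\mu_i,b_i)$ let $\gamma_\mu=\langle\mu_1,\mu_2,\ldots\rangle$ be the sequence of first coordinates, assumed a bad leader sequence; for $\mathbf{D}:\mathbb{N}\to\mathbb{N}$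 put $\mathbf{D}_{i_0}(i)=\mathbf{D}(i_0+i)$. Define $\mathfrak{h}_{n,m}(\mathbf{D},\gamma)$ by recursion on $\gamma_\mu$: if $\gamma_\mu$ is maximal (no extension by one derivative is a bad leader sequence), $\mathfrak{h}_{n,m}(\mathbf{D},\gamma)=1$. Otherwise set $w_{\mathbf{D}(1)}=1$ and, going down from $u=\mathbf{D}(1)$ to $u=0$: if $\gamma_\mu{}^\frown\langle u\rangle$ is not a bad leader sequence, $w_{u-1}=w_u$; if it is, put $v_{u,\mathbf{D}(w_u)}=w_u$, $v_{u,k-1}=v_{u,k}+\mathfrak{h}_{n,m}(\mathbf{D}_{v_{u,k}},\gamma^\frown\langle(u,k)\rangle)$ for $k=\mathbf{D}(w_u),\ldots,1$, and $w_{u-1}=v_{u,0}$. Then $\mathfrak{h}_{n,m}(\mathbf{D},\gamma)=w_{-1}$. Put $\mathfrak{h}_{n,m}(\mathbf{D})=\mathfrak{h}_{n,m}(\mathbf{D},\langle\rangle)$. - $\mathbf{F}^{\mathrm{char}}_c(k)=\mathfrak{z}^{c+\mathfrak{g}(c,k)}(\mathfrak{g}(c,k),c)$. Define $\mathbf{D}^{\mathrm{char}}_b(0)=b$ and, with $c=\mathbf{D}^{\mathrm{char}}_b(i)$, $\mathbf{F}=\mathbf{F}^{\mathrm{char}}_c$, $U=\mathfrak{u}^+_{\mathbf{F}}(c)$, $$\mathbf{D}^{\mathrm{char}}_b(i+1)=\max\left\{\mathfrak{g}\left(c,\tbinom{2c+m-1}{m-1}n(c+1)\right),\ \mathfrak{p}_U(\mathfrak{u}_{\mathbf{F}}(U)),\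 \mathfrak{f}(\mathbf{F},c)\right\}.$$ Finally $\mathfrak{i}^{\mathrm{char}}_{n,m}(b)=\mathbf{D}^{\mathrm{char}}_b(\mathfrak{h}_{n,m}(\mathbf{D}^{\mathrm{char}}_b))$. *)

(* Defs.v *)
From mathcomp Require Import all_boot all_order.
From mathcomp Require Import finmap multiset boolp.

Set Implicit Arguments.
Unset Strict Implicit.
Unset Printing Implicit Defensive.

Import Order.TTheory.

Definition bool_sum (b : bool) : {b = true} + {b = false} :=
  if b as c return {c = true} + {c = false} then left erefl else right erefl.

(** ** Ordinal iteration *)

(* Cantor normal forms below epsilon_0: [Cons e c r] is omega^e * (c + 1) + r,
   so every coefficient is positive. A term denotes an ordinal when its
   exponents strictly decrease, hereditarily; the operations below keep it so. *)
Inductive ord : Type := Zero | Cons (e : ord) (c : nat) (r : ord).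

Fixpoint ocmp (a b : ord) : comparison :=
  match a, b with
  | Zero, Zero => Eq
  | Zero, Cons _ _ _ => Lt
  | Cons _ _ _, Zero => Gt
  | Cons e c r, Cons e' c' r' =>
      match ocmp e e' with
      | Eq => if c < c' then Lt else if c' < c then Gt else ocmp r r'
      | o => o
      end
  end.

Fixpoint oadd (a b : ord) : ord :=
  match a, b with
  | Zero, _ => b
  | _, Zero => a
  | Cons e c r, Cons e' c' r' =>
      match ocmp e e' with
      | Lt => b
      | Eq => Cons e (c + c' + 1) r'
      | Gt => Cons e c (oadd r b)
      end
  end.

Definition omuln (a : ord) (k : nat) : ord := iter k (fun b => oadd b a) Zero.
Definition opow (e : ord) : ord := Cons e 0 Zero.
Definition ofin (k : nat) : ord := omuln (opow Zero) k.
Definition omega : ord := opow (ofin 1).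

(* omega^e * c + r, where the exponents of r are smaller than e *)
Definition cons_term (e : ord) (c : nat) (r : ord) : ord :=
  if c is c'.+1 then Cons e c' r else r.

(* alpha[x]; the last term of alpha is the one with exponent min alpha *)
Fixpoint fs (al : ord) (x : nat) : ord :=
  match al with
  | Zero => Zero
  | Cons Zero c Zero => cons_term Zero c Zero
  | Cons e c Zero => cons_term e c (cons_term (fs e x) x Zero)
  | Cons e c r => Cons e c (fs r x)
  end.

Definition fs_step (be al : ord) : Prop := al <> Zero /\ exists x, be = fs al x.

Lemma fs_step_fs e c r x : fs_step (fs (Cons e c r) x) (Cons e c r).
Proof. by split=> //; exists x. Qed.

Lemma fs_cons e c e1 c1 r1 x :
  fs (Cons e c (Cons e1 c1 r1)) x = Cons e c (fs (Cons e1 c1 r1) x).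
Proof. by case: e. Qed.

Lemma fs_wf : well_founded fs_step.
Proof.
have acc0 : Acc fs_step Zero by constructor=> ? [/(_ erefl)].
have accC e : Acc fs_step e ->
    forall c r, Acc fs_step r -> Acc fs_step (Cons e c r).
  elim=> {}e _ IHe c; have accx x : e <> Zero ->
    Acc fs_step (cons_term (fs e x) x Zero).
    case: x => [|x] e0; first exact: acc0.
    by apply: IHe; [split=> //; exists x.+1 | exact: acc0].
  elim: c => [|c IHc] r; elim=> {}r _ IHr; constructor=> _ [_ [x ->]];
    case: r IHr => [|e1 c1 r1] IHr.
  - by case: e accx {IHe IHr} => [|e2 c2 r2] accx; [exact: acc0 | exact: accx].
  - by rewrite fs_cons; apply: IHr; exact: fs_step_fs.
  - case: e accx IHc {IHe IHr} => [|e2 c2 r2] accx IHc; apply: IHc; first exact: acc0.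
    exact: accx.
  - by rewrite fs_cons; apply: IHr; exact: fs_step_fs.
by elim=> [|e acce c r accr]; [exact: acc0 | exact: accC].
Qed.

(* g^alpha(b) *)
Definition ord_iter_body (g : nat -> nat) (al : ord) :
    (forall be, fs_step be al -> nat -> nat) -> nat -> nat :=
  match al with
  | Zero => fun _ b => b
  | Cons e c r => fun rec b => rec (fs (Cons e c r) b) (fs_step_fs e c r b) (g b)
  end.

Definition ord_iter (g : nat -> nat) : ord -> nat -> nat :=
  Fix fs_wf (fun _ => nat -> nat) (ord_iter_body g).

Lemma ord_iterE g al b :
  ord_iter g al b = if al is Zero then b else ord_iter g (fs al b) (g b).
Proof.
rewrite /ord_iter Fix_eq; first by case: al.
by move=> [|e c r] f h fh //=; apply: funext => x; rewrite fh.
Qed.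

Definition calG (b : nat) : nat := b + 1.

Local Notation "a ⊕ b" := (oadd a b) (at level 50, left associativity).
Local Notation "a ⊗ k" := (omuln a k) (at level 40, left associativity).

Definition bound_ord (n m : nat) : ord :=
  opow (opow (ofin m) ⊗ (2 * n) ⊕ omega) ⊕ opow (opow (ofin m) ⊗ (2 * n) ⊕ ofin 1)
  ⊕ opow (omega ⊕ ofin 1) ⊕ opow omega ⊗ 2 ⊕ opow (ofin 2) ⊕ omega ⊗ 2.

(** ** Derivatives *)

(* The exponent vector of delta_1^k_1 ... delta_m^k_m. *)
Definition Theta (m : nat) := (m.-tuple nat)%type.

(* (k, r) is the derivative k X_(r+1). *)
Definition deriv (n m : nat) := (Theta m * 'I_n)%type.

Definition theta_act n m (t : Theta m) (u : deriv n m) : deriv n m :=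
  ([tuple tnth t i + tnth u.1 i | i < m], u.2).

Definition deriv_key n m (u : deriv n m) : seq nat :=
  sumn u.1 :: rcons u.1 (nat_of_ord u.2).

Definition dlt n m (u v : deriv n m) : bool :=
  (deriv_key u < deriv_key v :> seqlexi nat)%O.
Definition dle n m (u v : deriv n m) : bool :=
  (deriv_key u <= deriv_key v :> seqlexi nat)%O.

Definition divides n m (u v : deriv n m) : bool :=
  (u.2 == v.2) && [forall i : 'I_m, tnth u.1 i <= tnth v.1 i].

Lemma dividesP n m (u v : deriv n m) :
  reflect (exists t, theta_act t u = v) (divides u v).
Proof.
case: u v => [u r] [v s]; apply: (iffP andP) => /= [[/eqP-> /forallP le]|].
  exists [tuple tnth v i - tnth u i | i < m]; rewrite /theta_act /=.
  congr pair; apply: eq_from_tnth => i.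
  by rewrite !tnth_mktuple subnK // le.
case=> t [<- <-]; split=> //; apply/forallP=> i.
by rewrite tnth_mktuple leq_addl.
Qed.

(* The derivatives of order at most d, in increasing order. *)
Definition derivs_upto n m (d : nat) : seq (deriv n m) :=
  sort (@dle n m)
    [seq x : deriv n m <- [seq (map_tuple val t, r) | t <- enum {: m.-tuple 'I_d.+1}, r <- enum 'I_n]
       | sumn x.1 <= d].

(* Z_u for u >= 1. If m, n >= 1 there are at least d + 1 derivatives of order
   at most d, and they precede all the others, so Z_(d+1) is among them;
   [Z_eq_None], [Z_lt] and [Z_surj] below say that u |-> Z_u is the increasing
   enumeration of all derivatives. *)
Definition Z n m (u : nat) : option (deriv n m) :=
  if u is d.+1 then onth (derivs_upto n m d) d else None.

Definition bad_leader n m (s : seq (deriv n m)) : bool :=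
  sorted (@dlt n m) s && pairwise (fun u v => ~~ divides u v) s.

Lemma dlt_trans n m : transitive (@dlt n m).
Proof. by move=> y x z; exact: lt_trans. Qed.

Lemma deriv_key_inj n m : injective (@deriv_key n m).
Proof.
move=> [u r] [v s] [_ /rcons_inj[uv rs]].
by congr pair; [exact: val_inj | exact: val_inj].
Qed.

Lemma dle_eqVlt n m (u v : deriv n m) : dle u v = (u == v) || dlt u v.
Proof. by rewrite /dle le_eqVlt (inj_eq (@deriv_key_inj n m)). Qed.

Lemma mem_derivs_upto n m d (x : deriv n m) :
  (x \in derivs_upto n m d) = (sumn x.1 <= d).
Proof.
rewrite mem_sort mem_filter; case: (leqP (sumn x.1) d) => //= xd.
apply/allpairsP; exists ([tuple inord (tnth x.1 i) | i < m], x.2) => /=.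
split; rewrite ?mem_enum //; case: x xd => [u r] /= ud; congr pair.
apply: eq_from_tnth => i; rewrite tnth_map tnth_mktuple /= inordK // ltnS.
apply: leq_trans ud; rewrite sumnE big_tuple (bigD1 i) //=; exact: leq_addr.
Qed.

Lemma derivs_upto_uniq n m d : uniq (derivs_upto n m d).
Proof.
rewrite sort_uniq filter_uniq //; apply: allpairs_uniq; rewrite ?enum_uniq //.
move=> [t r] [t' r'] _ _ /= [/(inj_map val_inj) tt' ->].
by congr pair; exact: val_inj.
Qed.

Lemma dle_trans n m : transitive (@dle n m).
Proof. by move=> y x z; exact: le_trans. Qed.

Lemma dle_anti n m : antisymmetric (@dle n m).
Proof. by move=> x y /le_anti /deriv_key_inj. Qed.

Lemma derivs_upto_sorted n m d : sorted (@dle n m) (derivs_upto n m d).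
Proof. by apply: sort_sorted => x y; exact: le_total. Qed.

Lemma dlt_order n m (x y : deriv n m) : sumn x.1 < sumn y.1 -> dlt x y.
Proof.
by move=> xy; rewrite /dlt /deriv_key ltxi_cons !leEnat ltnW //= leqNgt xy.
Qed.

Lemma derivs_upto_prefix n m d d' : d <= d' ->
  prefix (derivs_upto n m d) (derivs_upto n m d').
Proof.
move=> dd'.
pose L := [seq x : deriv n m <- derivs_upto n m d' | d < sumn x.1].
suff -> : derivs_upto n m d' = derivs_upto n m d ++ L by exact: prefix_prefix.
apply: (sorted_eq (@dle_trans n m) (@dle_anti n m)).
- exact: derivs_upto_sorted.
- rewrite sorted_pairwise ?pairwise_cat -?sorted_pairwise; try exact: dle_trans.
  rewrite derivs_upto_sorted sorted_filter ?derivs_upto_sorted ?andbT //; last exact: dle_trans.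
  apply/allrelP => x y; rewrite mem_filter mem_derivs_upto => xd /andP[dy _].
  by rewrite dle_eqVlt dlt_order ?orbT //; exact: leq_ltn_trans dy.
apply: uniq_perm; first exact: derivs_upto_uniq.
  rewrite cat_uniq !(filter_uniq, derivs_upto_uniq) // andbT /=.
  by apply/hasPn => x; rewrite mem_filter => /andP[xd _]; rewrite mem_derivs_upto -ltnNge.
move=> x; rewrite mem_cat mem_filter !mem_derivs_upto.
by case: leqP => //= /leq_trans->.
Qed.
Lemma size_derivs_upto n m d : 0 < n -> 0 < m -> d < size (derivs_upto n m d).
Proof.
case: n => // n _; case: m => // m _.
pose f (k : nat) : deriv n.+1 m.+1 := ([tuple of k :: nseq m 0], ord0).
rewrite -(size_iota 0 d.+1) -(size_map f); apply: uniq_leq_size.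
  by rewrite map_inj_uniq ?iota_uniq // => i j [].
move=> _ /mapP[k + ->]; rewrite mem_iota mem_derivs_upto /= sumn_nseq mul0n addn0.
by rewrite add0n ltnS.
Qed.

Lemma Z_onth n m d d' : 0 < n -> 0 < m -> d <= d' ->
  Z n m d.+1 = onth (derivs_upto n m d') d.
Proof.
move=> n0 m0 /(derivs_upto_prefix n m)/prefixP[s ->] /=.
by rewrite !onthE map_cat nth_cat size_map size_derivs_upto.
Qed.

Lemma Z_eq_None n m u : 0 < n -> 0 < m -> (Z n m u == None) = (u == 0).
Proof.
move=> n0 m0; case: u => [|u] //=; rewrite onthE.
have us := size_derivs_upto u n0 m0.
by case: (derivs_upto n m u) us => // x s us; rewrite (nth_map x).
Qed.

Lemma Z_lt n m u v x y : 0 < n -> 0 < m ->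
  Z n m u = Some x -> Z n m v = Some y -> dlt x y = (u < v).
Proof.
move=> n0 m0; case: u v => [|u] [|v] // ux vy.
move: ux vy; rewrite (Z_onth n0 m0 (leq_maxl u v)) (Z_onth n0 m0 (leq_maxr u v)).
set d := maxn u v; move: (size_derivs_upto d n0 m0) => szd.
have us : u < size (derivs_upto n m d) by exact: leq_ltn_trans (leq_maxl u v) szd.
have vs : v < size (derivs_upto n m d) by exact: leq_ltn_trans (leq_maxr u v) szd.
move=> /(onth_nth x) <- /(onth_nth x) <-.
have dsort : sorted (@dlt n m) (derivs_upto n m d).
  have := derivs_upto_sorted n m d; have := derivs_upto_uniq n m d.
  rewrite !sorted_pairwise; try exact: dlt_trans; try exact: dle_trans.
  rewrite uniq_pairwise => h1 h2.
  have := conj h1 h2 => /andP; rewrite -pairwise_relI; apply: sub_pairwise => a b /=.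
  by rewrite dle_eqVlt => /andP[/negPf->].
have mono := sorted_ltn_nth (@dlt_trans n m) x dsort.
rewrite ltnS; case: (ltngtP u v) => [uv|vu|->]; first exact: mono.
  apply/negbTE/negP => /(dlt_trans (mono v u vs us vu)).
  by rewrite /dlt ltxx.
exact: ltxx.
Qed.

Lemma Z_surj n m (x : deriv n m) : 0 < n -> 0 < m -> exists u, Z n m u = Some x.
Proof.
move=> n0 m0; pose d := sumn x.1.
have xd : x \in derivs_upto n m d by rewrite mem_derivs_upto.
exists (index x (derivs_upto n m d)).+1.
set i := index _ _; have id : i < size (derivs_upto n m d) by rewrite index_mem.
have -> : Z n m i.+1 = onth (derivs_upto n m (maxn i d)) i.
  exact: Z_onth (leq_maxl _ _).
have /(derivs_upto_prefix n m)/prefixP[s ->] := leq_maxr i d.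
rewrite onthE map_cat nth_cat size_map id (nth_map x) //.
by rewrite nth_index.
Qed.

(** ** Well-foundedness of the extension of bad leader sequences *)

Lemma nat_argmin (f : nat -> nat) N :
  exists k, N <= k /\ forall j, N <= j -> f k <= f j.
Proof.
suff h b k : f k <= b -> N <= k ->
    exists k, N <= k /\ forall j, N <= j -> f k <= f j by exact: h (leqnn _) (leqnn N).
elim: b k => [|b IH] k fk Nk.
  by exists k; split=> // j _; move: fk; rewrite leqn0 => /eqP->.
have [[j Nj fj]|h] := pselect (exists2 j, N <= j & f j < f k).
  by apply: (IH j) => //; rewrite -ltnS; exact: leq_trans fj fk.
exists k; split=> // j Nj; rewrite leqNgt; apply/negP => fj.
by apply: h; exists j.
Qed.

Lemma monotone_subseq (f : nat -> nat) : exists g : nat -> nat,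
  {homo g : i j / i < j} /\ {homo f \o g : i j / i <= j}.
Proof.
have /choice [a aP] := nat_argmin f.
exists (fun i => iter i (a \o succn) (a 0)); split.
  apply: homo_ltn; first exact: ltn_trans.
  by move=> i /=; exact: (aP _).1.
apply: homo_leq => //; first exact: leq_trans.
move=> [|i] /=; first exact: (aP 0).2.
apply: (aP (iter i (a \o succn) (a 0)).+1).2.
by apply: leq_trans (aP _).1; apply: leq_trans (aP _).1.
Qed.

Lemma dickson_seq (T : Type) (f : nat -> T) (cs : seq (T -> nat)) :
  exists g : nat -> nat, {homo g : i j / i < j} /\
    forall k, k < size cs ->
      {homo (nth (fun=> 0) cs k \o f \o g) : i j / i <= j}.
Proof.
elim: cs => [|c cs [g [gm gP]]]; first by exists id; split.
have [h [hm hP]] := monotone_subseq (c \o f \o g).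
exists (g \o h); split=> [i j ij /=|]; first by apply: gm; exact: hm.
move=> [|k] /= ksz i j ij /=; first exact: hP.
apply: gP => //; move: ij; rewrite leq_eqVlt => /predU1P[->//|ij].
by apply: ltnW; exact: hm.
Qed.

Lemma dickson n m (f : nat -> deriv n m) :
  exists i j, i < j /\ divides (f i) (f j).
Proof.
pose cs : seq (deriv n m -> nat) :=
  [:: (fun u : deriv n m => nat_of_ord u.2), (fun u : deriv n m => n - u.2)
     & [seq (fun u : deriv n m => tnth u.1 i) | i <- enum 'I_m]].
have [g [gm gP]] := dickson_seq f cs.
exists (g 0), (g 1); split; first exact: gm.
apply/andP; split.
  have h0 : (f (g 0)).2 <= (f (g 1)).2 by exact: (gP 0).
  have h1 : n - (f (g 0)).2 <= n - (f (g 1)).2 by exact: (gP 1).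
  rewrite -val_eqE /= eqn_leq h0 /=.
  rewrite leqNgt; apply/negP => /(ltn_sub2l (ltn_ord _)).
  by rewrite ltnNge h1.
apply/forallP => i.
have := gP i.+2; rewrite /= size_map size_enum_ord !ltnS ltn_ord => /(_ isT).
move=> /(_ 0 1 isT) /=.
by rewrite (nth_map i) ?size_enum_ord // nth_ord_enum.
Qed.

Section Extension.
Variables n m : nat.
Implicit Type s : seq (deriv n m).

Definition ext_rel s' s : Prop := exists x, s' = rcons s x /\ bad_leader s'.

Lemma ext_wf : well_founded ext_rel.
Proof.
move=> s0; apply: contrapT => nacc0.
have next (s : {s | ~ Acc ext_rel s}) :
    exists t : {s | ~ Acc ext_rel s}, ext_rel (sval t) (sval s).
  case: s => s nacc /=; apply: contrapT => h; apply: nacc.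
  constructor=> t ts; apply: contrapT => nacct; apply: h.
  by exists (exist _ t nacct).
have /choice [F FP] := next.
pose S i := sval (iter i F (exist _ s0 nacc0)).
have SP i : exists x, S i.+1 = rcons (S i) x /\ bad_leader (S i.+1) by exact: FP.
have /choice [x xP] := SP.
have [i [j [ij dij]]] := dickson x.
have memS k l : k < l -> x k \in S l.
  elim: l => // l IH; rewrite ltnS (xP l).1 mem_rcons inE leq_eqVlt.
  by case/predU1P=> [->|/IH->]; rewrite ?eqxx ?orbT.
have := (xP j).2; rewrite {1}(xP j).1 => /andP[_].
rewrite -cats1 pairwise_cat => /and3P[/allrelP h _ _].
by have := h _ _ (memS _ _ ij) (mem_head _ _); rewrite dij.
Qed.

End Extension.

(** ** Bounding functions *)

Definition frd (r b : nat) : nat := (2 * b) ^ (2 ^ r).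
Definition fre (r b : nat) : nat :=
  2 ^ ((b + frd (r - 1) b) ^ (r - 1) + 1) * b + b + frd (r - 1) b.
Definition zeta0 (r d : nat) : nat := 'C(r + frd r d, r).
Definition zeta1 (r d b : nat) : nat := ('C(b + r, r) + 2) * zeta0 r d.
Definition zeta2 (r d b : nat) : nat :=
  (zeta1 r d b + 1) ^ (2 ^ zeta1 r d b - 1).

(* upsilon(r + 1, d), given p = p_r(d) *)
Definition upsilon_succ (r p d : nat) : nat := zeta1 r p d * zeta2 r p d.

(* p_r(d); the value at r = 0 is a convention, p_r being defined for r >= 1. *)
Fixpoint frp (r d : nat) : nat :=
  match r with
  | 0 | 1 => d
  | (r'.+1 as r1).+1 =>
      let v := upsilon_succ r1 (frp r1 d) d in
      maxn (2 * 'C(v + r, r) * v) (fre r1 d)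
  end.

Section Multiset.
Local Open Scope mset_scope.

Definition mset_min (tau : {mset nat}) : nat := head 0 (sort leq tau).

(* tau_<k,i,E> *)
Definition tau_sub (k i : nat) (E : nat -> nat) (tau : {mset nat}) : {mset nat} :=
  if 0 < k then (tau `\ k) `+` msetn (k * (E i - 1)) k.-1 else tau `\ k.

Definition tau_step (tau' tau : {mset nat}) : Prop :=
  exists k c, k \in tau /\
    tau' = (if 0 < k then (tau `\ k) `+` msetn c k.-1 else tau `\ k).

Lemma mset_minP (tau : {mset nat}) : tau != mset0 -> mset_min tau \in tau.
Proof.
move=> tau0; rewrite /mset_min.
have : perm_eq (sort leq tau) tau by rewrite perm_sort.
case: (sort leq tau) => [|k s] p; last first.
  by have := perm_mem p k; rewrite mem_head.
case/eqP: tau0; apply/msetP=> a; rewrite mset0E.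
by rewrite -count_mem_mset -(permP p).
Qed.

Lemma tau_step_sub E i (tau : {mset nat}) : tau != mset0 ->
  tau_step (tau_sub (mset_min tau) i E tau) tau.
Proof.
move=> /mset_minP tau0; exists (mset_min tau), (mset_min tau * (E i - 1)).
by split.
Qed.

Lemma tau_wf : well_founded tau_step.
Proof.
have step k : forall tau : {mset nat}, Acc tau_step tau -> Acc tau_step (k +` tau).
  elim: k => [|k IHk] tau; elim=> {}tau acct IHt; constructor=> t [j [c [jk ->]]].
    have [->|j0] := eqVneq j 0; first by rewrite /= msetD1K; exact: Acc_intro.
    move: jk; rewrite in_mset1D (negPf j0) /= => jt.
    have -> : (0 +` tau) `\ j = 0 +` (tau `\ j).
      apply/msetP=> a; rewrite !(msetB1E, mset1DE).
      by have [->|] := eqVneq a 0; rewrite ?subn0 ?add0n // eq_sym (negPf j0) !subn0.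
    by rewrite lt0n j0 -msetDA; apply: IHt; exists j, c; rewrite lt0n j0.
  have [->|jk1] := eqVneq j k.+1.
    rewrite /= msetD1K.
    elim: c => [|c IHc]; first by rewrite msetn0 msetD0; exact: Acc_intro.
    have -> : tau `+` msetn c.+1 k = k +` (tau `+` msetn c k).
      apply/msetP=> a; rewrite !(mset1DE, msetE2, msetnE).
      by case: eqVneq => _; rewrite ?addn0 // addnCA add1n.
    exact: IHk.
  move: jk; rewrite in_mset1D (negPf jk1) /= => jt.
  have -> : (k.+1 +` tau) `\ j = k.+1 +` (tau `\ j).
    apply/msetP=> a; rewrite !(msetB1E, mset1DE).
    by have [->|] := eqVneq a k.+1; rewrite ?add0n // eq_sym (negPf jk1) !subn0.
  by case: ifP => j0; rewrite -?msetDA; apply: IHt; exists j, c; rewrite j0.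
have acc0 : Acc tau_step mset0 by constructor=> t [k [c []]]; rewrite in_mset0.
move=> tau; rewrite -(seq_mset_id tau).
elim: (tau : seq nat) => [|k s IHs].
  by have -> : seq_mset [::] = mset0 :> {mset nat} by apply/msetP=> a; rewrite mset_seqE mset0E.
have -> : seq_mset (k :: s) = k +` seq_mset s :> {mset nat}; last exact: step.
by apply/msetP=> a; rewrite mset1DE !mset_seqE /= eq_sym.
Qed.

(* m_(tau,E)(i) *)
Definition frm_body (E : nat -> nat) (tau : {mset nat})
    (rec : forall tau', tau_step tau' tau -> nat -> nat) (i : nat) : nat :=
  match bool_sum (tau != mset0) with
  | left tau0 => 1 + rec _ (tau_step_sub E i tau0) i.+1
  | right _ => 0
  end.

Definition frm (E : nat -> nat) : {mset nat} -> nat -> nat :=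
  Fix tau_wf (fun _ => nat -> nat) (@frm_body E).

Lemma frmE E tau i : frm E tau i =
  if tau == mset0 then 0 else 1 + frm E (tau_sub (mset_min tau) i E tau) i.+1.
Proof.
rewrite {1}/frm Fix_eq => [|t f h fh].
  rewrite /frm_body; case: bool_sum => [tau0|/negbFE->] //.
  by rewrite (negPf tau0).
by apply: funext => j; rewrite /frm_body; case: bool_sum => // t0; rewrite fh.
Qed.

(* m^*(D,r) *)
Definition mstar (D : nat -> nat) (r : nat) : nat :=
  frm (fun i => D i + 1) [mset r] 0 + 1.

End Multiset.

(* F_x(b) *)
Definition Fsub (F : nat -> nat) (x b : nat) : nat := F (frp x b).
(* u_F(x) *)
Definition fru (F : nat -> nat) (x : nat) : nat :=
  iter (mstar (fun i => iter i (Fsub F x) x) x) (Fsub F x) x.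
(* u^+_F(b) *)
Definition fru_plus (F : nat -> nat) (b : nat) : nat :=
  maxn (fru F b) (frd (b + 1) (2 * b * 'C(2 * b, b) + 1)).
Definition frf (F : nat -> nat) (b : nat) : nat :=
  let u := fru_plus F b in
  let N := frd u u + u in
  frd u ('C(N + b, b) * u) + N.
Definition frg (b d : nat) : nat := d * (1 + b) ^ d.

(* z^k(d,b) *)
Fixpoint frz (k d b : nat) : nat :=
  if k is k'.+1 then
    let G := frg (b + d - 1) (maxn (b + d - 1) (2 * b)) in
    frz k' (frd (b + d) ((G + d + 1) * 'C(2 * b, b) * (2 * b) + d) + G + d + 1) b
  else d.

(* D_(i0) *)
Definition shift (D : nat -> nat) (i0 i : nat) : nat := D (i0 + i).

Section H.
Variables n m : nat.
Local Notation gseq := (seq (deriv n m * nat)).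
Implicit Type ga : gseq.

(* gamma_mu *)
Definition leaders ga : seq (deriv n m) := [seq p.1 | p <- ga].

Definition hext (ga' ga : gseq) : Prop :=
  exists u k, ga' = rcons ga (u, k) /\ bad_leader (rcons (leaders ga) u).

Lemma hextI ga u k : bad_leader (rcons (leaders ga) u) -> hext (rcons ga (u, k)) ga.
Proof. by exists u, k. Qed.

Lemma hext_wf : well_founded hext.
Proof.
move=> ga; have := ext_wf (leaders ga); move: {-2}(leaders ga) (erefl (leaders ga)).
move=> s + accs; elim: accs ga => {}s _ IH ga gas; constructor=> _ [u [k [-> b]]].
apply: (IH (rcons s u)); last by rewrite gas /leaders map_rcons.
by exists u; split; rewrite // gas.
Qed.

Definition maximal ga : Prop := ~ exists u, bad_leader (rcons (leaders ga) u).

(* v_(u,0) from v_(u,K) = v, where f k v is h(D_v, gamma^<(u,k)>). *)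
Fixpoint vloop (f : nat -> nat -> nat) (K v : nat) : nat :=
  if K is k.+1 then vloop f k (v + f K v) else v.

(* w_(-1) from w_U = w, where step u w_u is w_(u-1). *)
Fixpoint wloop (step : nat -> nat -> nat) (U w : nat) : nat :=
  if U is u.+1 then wloop step u (step U w) else step 0 w.

Definition h_body ga (rec : forall ga', hext ga' ga -> (nat -> nat) -> nat)
    (D : nat -> nat) : nat :=
  if `[< maximal ga >] then 1 else
  wloop (fun u w =>
    if Z n m u is Some x then
      match bool_sum (bad_leader (rcons (leaders ga) x)) with
      | left bx =>
          vloop (fun k v => rec (rcons ga (x, k)) (hextI k bx) (shift D v)) (D w) w
      | right _ => w
      end
    else w) (D 1) 1.

(* h_(n,m)(D,gamma) *)
Definition frh_seq (D : nat -> nat) ga : nat :=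
  Fix hext_wf (fun _ => (nat -> nat) -> nat) h_body ga D.

Definition frh (D : nat -> nat) : nat := frh_seq D [::].

Lemma eq_vloop f g : (forall k v, f k v = g k v) -> vloop f =2 vloop g.
Proof. by move=> fg; elim=> //= k IH v; rewrite fg IH. Qed.

Lemma eq_wloop f g : (forall k v, f k v = g k v) -> wloop f =2 wloop g.
Proof. by move=> fg; elim=> [|k IH] v /=; rewrite fg ?IH. Qed.

Lemma frh_seqE D ga : frh_seq D ga =
  if `[< maximal ga >] then 1 else
  wloop (fun u w =>
    if Z n m u is Some x then
      if bad_leader (rcons (leaders ga) x) then
        vloop (fun k v => frh_seq (shift D v) (rcons ga (x, k))) (D w) w
      else w
    else w) (D 1) 1.
Proof.
rewrite {1}/frh_seq Fix_eq => [|g f h fh]; last first.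
  apply: funext => E; rewrite /h_body; case: ifP => // _.
  apply: eq_wloop => u w; case: (Z n m u) => // x.
  by case: bool_sum => // bx; apply: eq_vloop => k v; rewrite fh.
rewrite {1}/h_body; case: ifP => // _.
apply: eq_wloop => u w; case: (Z n m u) => // x.
by case: bool_sum => ->.
Qed.

End H.

(** ** The characteristic set bound *)

Definition Fchar (c k : nat) : nat := frz (c + frg c k) (frg c k) c.

Fixpoint Dchar (n m b i : nat) : nat :=
  if i is i'.+1 then
    let c := Dchar n m b i' in
    let F := Fchar c in
    let U := fru_plus F c in
    maxn (frg c ('C(2 * c + m - 1, m - 1) * n * (c + 1)))
      (maxn (frp U (fru F U)) (frf F c))
  else b.

Definition ichar (n m b : nat) : nat := Dchar n m b (frh n m (Dchar n m b)).

(* Main.v *)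
(* Write F_e for the Hardy function G^(omega^e), so that F_0 b = b + 1 and
   F_e b = F_(e[b])^b (b + 1). Three estimates are combined.

   Elementary operations are bounded by iterates of F_2, hence z^k and p_r by
   F_5, the functions F^char by F_6, and the multiset recursion m^* on {r} by
   F_(2 r + 8); thus one step of D^char is bounded by six iterations of
   F_omega, and a fortiori by F_(omega + 2).

   For h, cover the derivatives divisible by no element of a bad leader
   sequence by boxes in which some exponents are free and the others fixed. A
   further leader x splits the box containing x into boxes with one more
   exponent fixed, at most |x| of them, so the ordinal
   (sum over the boxes of omega^(number of free exponents)) decreases, and its
   coefficients stay below the current value of D. The two nested loops of h
   are absorbed by this decrease. Starting from n boxes with m free exponents,
   this bounds i^char by F_(omega^m n + omega + 3), and that exponent is smaller
   than omega^m 2n + omega. The remaining summands of the bound are only needed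
   to make the argument exceed the coefficients in play. *)

From mathcomp Require Import all_boot all_order.
From mathcomp Require Import finmap multiset boolp zify.
Require Import Defs.

Set Implicit Arguments.
Unset Strict Implicit.
Unset Printing Implicit Defensive.

(** * Fundamental sequences and the Hardy hierarchy *)

(** The step-down relation of Ketonen and Solovay. Hardy functions are monotone along it at
    arguments at least x, which fails for the plain order on ordinals. *)
Inductive reach (x : nat) : ord -> ord -> Prop :=
| reach_refl al : reach x al al
| reach_step al be : al <> Zero -> reach x (fs al x) be -> reach x al be.

Lemma reach_inv x al be :
  reach x al be -> al = be \/ al <> Zero /\ reach x (fs al x) be.
Proof. by case=> {al be} [al|al be al0 ab]; [left | right]. Qed.

Lemma reach_trans x al be ga : reach x al be -> reach x be ga -> reach x al ga.
Proof.
by elim=> // {}al {}be al0 _ IH /IH; exact: reach_step.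
Qed.

Lemma fs_ctx e c r x : r <> Zero -> fs (Cons e c r) x = Cons e c (fs r x).
Proof. by case: r => // e1 c1 r1 _; exact: fs_cons. Qed.

Lemma reach_ctx x e c r r' : reach x r r' -> reach x (Cons e c r) (Cons e c r').
Proof.
elim=> [{}r|{}r {}r' r0 _ IH]; first exact: reach_refl.
by apply: reach_step; rewrite ?fs_ctx.
Qed.

Lemma reach_Zero x al : reach x al Zero.
Proof.
elim/(well_founded_ind fs_wf): al => al IH.
case: al IH => [|e c r] IH; first exact: reach_refl.
by apply: reach_step => //; apply: IH; exact: fs_step_fs.
Qed.

Lemma reach_cons_term x e c r r' :
  reach x r r' -> reach x (cons_term e c r) (cons_term e c r').
Proof. by case: c => [|c] //=; exact: reach_ctx. Qed.

Lemma fs_coef e c x : fs (Cons e c Zero) x = cons_term e c (fs (opow e) x).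
Proof. by case: e. Qed.

Lemma fs_opow e x : e <> Zero -> fs (opow e) x = cons_term (fs e x) x Zero.
Proof. by case: e. Qed.

Lemma reach_coef x e c c' :
  c' <= c -> reach x (cons_term e c Zero) (cons_term e c' Zero).
Proof.
move=> /subnK <-; elim: (c - c') => [|k IH]; first exact: reach_refl.
apply: reach_step; first by [].
rewrite addSn fs_coef; apply: reach_trans IH.
by apply: reach_cons_term; exact: reach_Zero.
Qed.

Lemma reach_opow x al be : 0 < x -> reach x al be -> reach x (opow al) (opow be).
Proof.
move=> x0; elim=> [{}al|{}al {}be al0 _ IH]; first exact: reach_refl.
apply: reach_step => //; rewrite fs_opow //; apply: reach_trans IH.
exact: (@reach_coef x (fs al x) x 1).
Qed.

Lemma reach_fs_fs al x y : x <= y -> reach x (fs al y) (fs al x).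
Proof.
move=> xy; elim: al => [|e IHe c r IHr]; first exact: reach_refl.
case: r IHr => [|e1 c1 r1] IHr; last first.
  by rewrite !fs_cons; exact: reach_ctx.
rewrite (fs_coef _ _ y) (fs_coef _ _ x); apply: reach_cons_term => {IHr}.
have [->|e0] := EM (e = Zero); first exact: reach_refl.
rewrite !fs_opow //.
have [->|x0] := posnP x; first exact: reach_Zero.
apply: reach_trans (reach_coef _ _ xy) _.
elim: IHe => [al|al be al0 _ IH]; first exact: reach_refl.
(* Dropping to a single omega^al lets one step recreate x copies, now with exponent al[x]. *)
apply: reach_trans (reach_coef x al x0) _.
by apply: reach_step => //; rewrite fs_opow.
Qed.

Notation hardy := (ord_iter calG).

Lemma hardy_mono_reach al :
  (forall b b', b <= b' -> hardy al b <= hardy al b') /\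
  (forall x be b, x <= b -> reach x al be -> hardy be b <= hardy al b).
Proof.
elim/(well_founded_ind fs_wf): al => al IH.
have [->|al0] := EM (al = Zero).
  split=> [b b'|x be b xb]; first by rewrite ![hardy Zero _]ord_iterE.
  by case/reach_inv=> [<-|[]].
have {}IH x : (forall b b', b <= b' -> hardy (fs al x) b <= hardy (fs al x) b') /\
  (forall y be b, y <= b -> reach y (fs al x) be -> hardy be b <= hardy (fs al x) b).
  by apply: IH; split=> //; exists x.
have hE b : hardy al b = hardy (fs al b) b.+1.
  by rewrite ord_iterE /calG addn1; case: (al) al0.
split=> [b b' bb'|x be b xb].
  rewrite !hE; apply: leq_trans ((IH b').1 b.+1 b'.+1 _) => //.
  by apply: (IH b').2 (reach_fs_fs al bb').
case/reach_inv=> [<-//|[_ albe]]; rewrite hE.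
apply: leq_trans ((IH b).1 _ _ (leqnSn b)).
apply: leq_trans ((IH b).2 _ _ _ xb (reach_fs_fs al xb)).
exact: (IH x).2 albe.
Qed.

Lemma hardy_mono al b b' : b <= b' -> hardy al b <= hardy al b'.
Proof. exact: (hardy_mono_reach al).1. Qed.

Lemma hardy_reach al be x b : reach x al be -> x <= b -> hardy be b <= hardy al b.
Proof. by move=> ab xb; exact: (hardy_mono_reach al).2 xb ab. Qed.

Lemma hardy_Cons e c r b : hardy (Cons e c r) b = hardy (Cons e c Zero) (hardy r b).
Proof.
elim/(well_founded_ind fs_wf): r b => r IH b.
have [->|r0] := EM (r = Zero); first by rewrite [hardy Zero b]ord_iterE.
rewrite [LHS]ord_iterE fs_ctx // IH; last by split=> //; exists b.
by congr (hardy _ _); rewrite [RHS]ord_iterE; case: r r0 {IH}.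
Qed.

Lemma hardy_coef e c b : hardy (cons_term e c Zero) b = iter c (hardy (opow e)) b.
Proof.
elim: c b => [|c IH] b; first by rewrite /= ord_iterE.
rewrite iterSr -IH [hardy (opow e) b]ord_iterE [LHS]ord_iterE fs_coef.
case: c IH => [|c] _; first by rewrite /= [RHS]ord_iterE.
exact: hardy_Cons.
Qed.

Definition fgh (e : ord) (b : nat) : nat := hardy (opow e) b.

Lemma fgh0 b : fgh Zero b = b.+1.
Proof. by rewrite /fgh ord_iterE /= ord_iterE /calG addn1. Qed.

Lemma fghE e b : e <> Zero -> fgh e b = iter b (fgh (fs e b)) b.+1.
Proof.
by move=> e0; rewrite /fgh ord_iterE fs_opow // hardy_coef /calG addn1.
Qed.

Lemma fgh_mono e b b' : b <= b' -> fgh e b <= fgh e b'.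
Proof. exact: hardy_mono. Qed.

Lemma fgh_gt e b : b < fgh e b.
Proof.
case: b => [|b].
  by rewrite /fgh ord_iterE /=; case: e => [|e c r]; rewrite ord_iterE.
rewrite -[leqLHS]fgh0.
apply: (@hardy_reach _ _ b.+1) => //; apply: reach_opow => //.
exact: reach_Zero.
Qed.

Lemma fgh_reach x e e' b : 0 < x -> x <= b -> reach x e e' -> fgh e' b <= fgh e b.
Proof. by move=> x0 xb ee'; apply: hardy_reach xb; exact: reach_opow. Qed.

(** * Ordinals below omega^omega as coefficient vectors *)

Fixpoint ovec (d : nat) (a : nat -> nat) : ord :=
  if d is d'.+1 then cons_term (ofin d') (a d') (ovec d' a) else Zero.

Lemma ocmp_refl e : ocmp e e = Eq.
Proof. by elim: e => //= e -> c r ->; rewrite ltnn. Qed.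

Lemma omuln_opow e k : omuln (opow e) k = cons_term e k Zero.
Proof.
rewrite /omuln; elim: k => // k IH; rewrite iterS IH.
by case: k {IH} => //= k; rewrite ocmp_refl addn0 addn1.
Qed.

Lemma ofinE k : ofin k = cons_term Zero k Zero.
Proof. exact: omuln_opow. Qed.

Lemma fs_ofinS k x : fs (ofin k.+1) x = ofin k.
Proof. by rewrite !ofinE. Qed.

Lemma ofin_neq0 k : 0 < k -> ofin k <> Zero.
Proof. by case: k => // k _; rewrite ofinE. Qed.

(** The strict bound a j < x leaves a spare copy of omega^j at every level, and expanding it
    supplies the levels below. *)
Lemma reach_fs_opow_ovec k a x : (forall j, j < k -> a j < x) ->
  reach x (fs (opow (ofin k)) x) (ovec k a).
Proof.
elim: k => [|k IH] ax; first exact: reach_Zero.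
rewrite fs_opow; last exact: ofin_neq0.
rewrite fs_ofinS; apply: reach_trans (reach_coef _ _ (ax k (ltnSn k))) _.
apply: reach_step => //; rewrite fs_coef; apply: reach_cons_term.
by apply: IH => j jk; apply: ax; exact: ltnW.
Qed.

Lemma ovec_neq0 d a k : k < d -> 0 < a k -> ovec d a <> Zero.
Proof.
elim: d => // d IH; rewrite ltnS leq_eqVlt => /predU1P[->|kd] ak /=.
  by case: (a d) ak.
by case: (a d) => [|c] //=; exact: IH.
Qed.

(** Lexicographic descent, started from al[x] instead of al because F_al x iterates F_(al[x]). *)
Lemma reach_fs_ovec d k a a' x : k < d ->
  (forall j, k < j < d -> a' j = a j) -> a' k < a k ->
  (forall j, j < k -> a' j < x) ->
  reach x (fs (ovec d a) x) (ovec d a').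
Proof.
elim: d => // d IH; rewrite ltnS leq_eqVlt => /predU1P[->|kd] aa' ak ax /=.
  case: (a d) ak => // c; rewrite ltnS => ac.
  (* The case of a single term; a nonzero tail is first run down to Zero. *)
  have h : reach x (fs (cons_term (ofin d) c.+1 Zero) x)
      (cons_term (ofin d) (a' d) (ovec d a')).
    have [->|ltac] := eqVneq (a' d) c.
      by rewrite fs_coef; apply: reach_cons_term; exact: reach_fs_opow_ovec.
    rewrite fs_coef; apply: reach_trans (reach_cons_term _ _ (reach_Zero _ _)) _.
    have {ac ltac} ac : a' d < c by rewrite ltn_neqAle ltac.
    apply: reach_trans (reach_coef _ _ ac) _.
    apply: reach_step => //; rewrite fs_coef; apply: reach_cons_term.
    exact: reach_fs_opow_ovec.
  have [->//|r0] := EM (ovec d a = Zero).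
  rewrite fs_ctx //; apply: reach_trans (reach_ctx _ _ (reach_Zero _ _)) _.
  exact: reach_step.
have r0 : ovec d a <> Zero by apply: ovec_neq0 kd _; exact: leq_ltn_trans ak.
rewrite aa' ?kd ?ltnS ?leqnn //.
have {}IH : reach x (fs (ovec d a) x) (ovec d a').
  apply: IH => // j /andP[kj jd]; apply: aa'; rewrite kj; exact: ltnW.
case: (a d) => [//|c]; rewrite /cons_term fs_ctx //; exact: reach_ctx.
Qed.

Lemma reach_ovec d a a' x : (forall j, j < d -> a' j <= a j) ->
  (forall j, j < d -> a' j < x) -> reach x (ovec d a) (ovec d a').
Proof.
elim: d => [|d IH] aa' ax /=; first exact: reach_refl.
have := aa' d (ltnSn d); rewrite leq_eqVlt => /predU1P[->|ad].
  by apply: reach_cons_term; apply: IH => j jd; [apply: aa'|apply: ax]; exact: ltnW.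
apply: (@reach_step x (ovec d.+1 a)).
  by apply: (@ovec_neq0 _ _ d) => //; exact: leq_ltn_trans ad.
apply: (@reach_fs_ovec _ d) => // [j|j jd]; last by apply: ax; exact: ltnW.
by move=> /andP[dj]; rewrite ltnS leqNgt dj.
Qed.

Lemma leq_iter2 (f g : nat -> nat) k x y :
    (forall s t, x <= s -> s <= t -> f s <= g t) -> (forall s, s <= f s) ->
  x <= y -> iter k f x <= iter k g y.
Proof.
move=> fg fs_ge xy; suff [] : x <= iter k f x /\ iter k f x <= iter k g y by [].
elim: k => [//|k [IH1 IH2]] /=; split; last exact: fg.
exact: leq_trans IH1 _.
Qed.

Lemma leq_iter_fgh e k x y : x <= y -> iter k (fgh e) x <= iter k (fgh e) y.
Proof.
by apply: leq_iter2 => [s t _|s]; [exact: fgh_mono | exact/ltnW/fgh_gt].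
Qed.

Lemma iter_fgh_ge e k x : k + x <= iter k (fgh e) x.
Proof. by elim: k => // k IH /=; apply: leq_ltn_trans IH (fgh_gt _ _). Qed.

Lemma leq_iter_count e k k' x : k <= k' -> iter k (fgh e) x <= iter k' (fgh e) x.
Proof.
move=> /subnK <-; rewrite iterD.
by apply: leq_trans (iter_fgh_ge _ _ _); exact: leq_addl.
Qed.

(** A strict lexicographic decrease pays for b iterations: F_a b consists of b iterations of
    F_(a[b]), and [reach_fs_ovec] places a' below a[b]. *)
Lemma fgh_lex d k a a' b : k < d ->
    (forall j, k < j < d -> a' j = a j) -> a' k < a k ->
    (forall j, j < k -> a' j < b) ->
  iter b (fgh (ovec d a')) b.+1 <= fgh (ovec d a) b.
Proof.
move=> kd aa' ak ab; rewrite fghE; last by apply: ovec_neq0 kd _; exact: leq_ltn_trans ak.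
case: b ab => // b ab; apply: leq_iter2 => // [s t bs st|s]; last exact/ltnW/fgh_gt.
apply: leq_trans (fgh_mono _ st) _; apply: (@fgh_reach b.+1) => //.
  by apply: leq_trans st; exact: ltnW.
exact: reach_fs_ovec ab.
Qed.

Lemma fgh_lex1 d k a a' b : 0 < b -> k < d ->
    (forall j, k < j < d -> a' j = a j) -> a' k < a k ->
    (forall j, j < k -> a' j < b) ->
  fgh (ovec d a') b <= fgh (ovec d a) b.
Proof.
move=> b0 kd aa' ak ab; apply: leq_trans (fgh_lex kd aa' ak ab).
apply: leq_trans (leq_iter_count _ _ b0); exact: fgh_mono.
Qed.

(** * Elementary and primitive recursive bounds *)

Definition fn (k : nat) : nat -> nat := fgh (ofin k).

Lemma fnS k b : fn k.+1 b = iter b (fn k) b.+1.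
Proof. by rewrite /fn fghE ?fs_ofinS //; exact: ofin_neq0. Qed.

Lemma fn_gt k b : b < fn k b.
Proof. exact: fgh_gt. Qed.

Lemma fn_mono k b b' : b <= b' -> fn k b <= fn k b'.
Proof. exact: fgh_mono. Qed.

Lemma fn1 b : fn 1 b = b + b.+1.
Proof.
rewrite fnS; elim: {1 3}b => // k IH.
by rewrite iterS IH /fn fgh0.
Qed.

Lemma fn2 b : fn 2 b = (2 ^ b * b.+2).-1.
Proof.
(* F_1 doubles t + 1, so b applications multiply the successor of the start by 2 ^ b; the start is
   generalized to c + 1. *)
rewrite fnS; move: {2 4}b => c; elim: b c => [|k IH] c; first by rewrite mul1n.
rewrite iterS IH fn1 expnS.
have : 0 < 2 ^ k * c.+2 by rewrite muln_gt0 expn_gt0.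
nia.
Qed.

Lemma leq_fn i j b : 0 < b -> i <= j -> fn i b <= fn j b.
Proof.
move=> b0 ij; apply: (@fgh_reach b) => //; rewrite !ofinE; exact: reach_coef.
Qed.

Lemma iter_fn k j b : j <= b -> iter j (fn k) b <= fn k.+1 b.
Proof.
move=> jb; rewrite fnS; apply: leq_trans (leq_iter_count _ _ jb) _.
exact: leq_iter_fgh.
Qed.

(** Elementary expressions in quantities at most x are measured by a number k of iterations of F_2
    that dominates them. The rules below compute such a k along the syntax, and [e2_bound] automates
    them. *)
Definition e2 (k x : nat) : nat := iter k (fn 2) x.

Lemma e2_le k k' x : k <= k' -> e2 k x <= e2 k' x.
Proof. exact: leq_iter_count. Qed.

Lemma e2_ge k x : x <= e2 k x.
Proof. by apply: leq_trans (iter_fgh_ge _ _ _); exact: leq_addl. Qed.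

Lemma fn2_ge_exp b : 2 ^ b <= fn 2 b.
Proof. rewrite fn2; have : 0 < 2 ^ b by rewrite expn_gt0. nia. Qed.

Lemma fn2_ge_sqr b : b * b <= fn 2 b.
Proof.
rewrite fn2; have := ltn_expl b (ltnSn 1). nia.
Qed.

Lemma e2_var a x : a <= x -> a <= e2 0 x.
Proof. by []. Qed.

Lemma e2_mul i j a b x : 0 < x ->
  a <= e2 i x -> b <= e2 j x -> a * b <= e2 (maxn i j).+1 x.
Proof.
move=> x0 ai bj; apply: leq_trans (fn2_ge_sqr _).
apply: leq_mul; [apply: leq_trans ai _|apply: leq_trans bj _]; apply: e2_le; lia.
Qed.

Lemma e2_add i j a b x : 1 < x ->
  a <= e2 i x -> b <= e2 j x -> a + b <= e2 (maxn i j).+1 x.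
Proof.
move=> x1 ai bj; apply: leq_trans (fn2_ge_sqr _).
have ai' : a <= e2 (maxn i j) x by apply: leq_trans ai _; apply: e2_le; lia.
have bj' : b <= e2 (maxn i j) x by apply: leq_trans bj _; apply: e2_le; lia.
have := leq_trans x1 (e2_ge (maxn i j) x); rewrite -/(e2 _ _) => X1.
apply: leq_trans (leq_add ai' bj') _; rewrite addnn -mul2n leq_mul2r.
by rewrite X1 orbT.
Qed.

Lemma e2_sub i a b x : a <= e2 i x -> a - b <= e2 i x.
Proof. exact: leq_trans (leq_subr _ _). Qed.

Lemma e2_max i j a b x : a <= e2 i x -> b <= e2 j x -> maxn a b <= e2 (maxn i j) x.
Proof.
move=> ai bj; rewrite geq_max; apply/andP; split.
  by apply: leq_trans ai _; apply: e2_le; lia.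
by apply: leq_trans bj _; apply: e2_le; lia.
Qed.

Lemma e2_exp i j a b x : 0 < x ->
  a <= e2 i x -> b <= e2 j x -> a ^ b <= e2 (maxn i j).+2 x.
Proof.
move=> x0 ai bj; apply: (@leq_trans (2 ^ (a * b))).
  rewrite expnM; case: (b) => // c; rewrite leq_exp2r //.
  by apply: ltnW; exact: ltn_expl.
apply: leq_trans (fn2_ge_exp _); rewrite leq_exp2l //; exact: e2_mul.
Qed.

Lemma leq_bin_exp a b : 'C(a, b) <= 2 ^ a.
Proof.
have [ab|ba] := leqP b a; last by rewrite bin_small.
have -> : 2 ^ a = \sum_(i < a.+1) 'C(a, i).
  rewrite -[2]/(1 + 1) expnDn; apply: eq_bigr => i _.
  by rewrite !exp1n !muln1.
have ab' : b < a.+1 by [].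
by rewrite (bigD1 (Ordinal ab')) //= leq_addr.
Qed.

Lemma e2_bin i a b x : a <= e2 i x -> 'C(a, b) <= e2 i.+1 x.
Proof.
move=> ai; apply: leq_trans (leq_bin_exp _ _) _.
by apply: leq_trans (fn2_ge_exp _); rewrite leq_exp2l.
Qed.

Lemma fn3_ge x : 2 < x -> 30 < fn 3 x.
Proof.
move=> x2; have := @iter_fn 2 1 x (ltnW (ltnW x2)); apply: leq_trans.
by apply: leq_trans (@fn_mono 2 3 _ x2); rewrite fn2.
Qed.

Lemma fn_fn k x : 1 < x -> fn k (fn k x) <= fn k.+1 x.
Proof. by move=> x1; exact: (@iter_fn k 2). Qed.

(** The number 30 bounds the cost of every elementary expression estimated below. Since F_3 x > 30,
    F_3 (F_3 x) dominates 31 iterations of F_2. *)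
Lemma e2_fn4 x : 2 < x -> e2 30 x < fn 4 x.
Proof.
move=> x2; apply: leq_trans (fn_fn 3 (ltnW x2)).
apply: leq_trans (iter_fn 2 (fn3_ge x2)).
rewrite iterS; apply: leq_ltn_trans (fn_gt _ _).
by apply: leq_iter_fgh; exact/ltnW/fn_gt.
Qed.

Ltac e2_rec :=
  lazymatch goal with
  | |- is_true (_ + _ <= _) => apply: e2_add; [lia | e2_rec | e2_rec]
  | |- is_true (_ * _ <= _) => apply: e2_mul; [lia | e2_rec | e2_rec]
  | |- is_true (_ - _ <= _) => apply: e2_sub; e2_rec
  | |- is_true (_ ^ _ <= _) => apply: e2_exp; [lia | e2_rec | e2_rec]
  | |- is_true (maxn _ _ <= _) => apply: e2_max; [e2_rec | e2_rec]
  | |- is_true (binomial _ _ <= _) => apply: e2_bin; e2_rec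
  | _ => apply: e2_var; lia
  end.

Ltac e2_bound :=
  match goal with |- is_true (_ <= e2 _ ?x) =>
    apply: (@leq_trans (e2 _ x)); [e2_rec | by apply: e2_le] end.

Lemma frz_le k d b x : 2 < x -> d <= x -> b <= x -> frz k d b <= iter k (fn 4) x.
Proof.
elim: k d x => [//|k IH] d x x2 dx bx; rewrite iterSr; apply: IH.
- exact: ltn_trans x2 (fn_gt _ _).
- apply: leq_trans (ltnW (e2_fn4 x2)); rewrite /frd /frg; e2_bound.
- exact: leq_trans bx (ltnW (fn_gt _ _)).
Qed.

(** The number of rounds of z and its starting value are elementary, hence at most F_4 x; that many
    iterations of F_4 are absorbed by F_5. *)
Lemma Fchar_le c k x : 2 < x -> c <= x -> k <= x -> Fchar c k <= fn 6 x.
Proof.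
move=> x2 cx kx; apply: leq_trans (fn_fn 5 (ltnW x2)).
apply: (@leq_trans (fn 5 (fn 4 x))); last by apply: fn_mono; apply: leq_fn => //; exact: ltnW (ltnW x2).
have y2 : 2 < fn 4 x by exact: ltn_trans x2 (fn_gt _ _).
have le a : a <= e2 30 x -> a <= fn 4 x.
  by move=> h; apply: leq_trans h (ltnW (e2_fn4 x2)).
have kx' : c + frg c k <= fn 4 x by apply: le; rewrite /frg; e2_bound.
apply: leq_trans (iter_fn 4 kx'); apply: frz_le => //; last by lia.
by apply: leq_trans kx'; exact: leq_addl.
Qed.

Lemma frp_le r d x : 2 < x -> r <= x -> d <= x -> frp r d <= iter r (fn 4) x.
Proof.
move=> x2 + dx; elim: r => [//|[|r] IH] rx.
  exact: leq_trans dx (ltnW (fn_gt _ _)).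
have {IH} := IH (ltnW rx); rewrite [iter r.+2 _ _]iterS.
move: (iter _ _ _) (iter_fgh_ge (ofin 4) r.+1 x) => y ry pd.
have y2 : 2 < y by lia.
apply: leq_trans (ltnW (e2_fn4 y2)).
have -> : frp r.+2 d = let v := upsilon_succ r.+1 (frp r.+1 d) d in
  maxn (2 * 'C(v + r.+2, r.+2) * v) (fre r.+1 d) by [].
move: (frp r.+1 d) pd => p pd; cbv zeta.
rewrite /upsilon_succ /zeta2 /zeta1 /zeta0 /fre /frd; e2_bound.
Qed.

Lemma frp_fn5 r d x : 2 < x -> r <= x -> d <= x -> frp r d <= fn 5 x.
Proof.
by move=> x2 rx dx; apply: leq_trans (frp_le x2 rx dx) (iter_fn _ rx).
Qed.

Lemma Fsub_le c r d x : 2 < x -> c <= x -> r <= x -> d <= x ->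
  Fsub (Fchar c) r d <= fn 7 x.
Proof.
move=> x2 cx rx dx; apply: leq_trans (fn_fn 6 (ltnW x2)).
have x6 : x <= fn 6 x by exact/ltnW/fn_gt.
apply: Fchar_le; [by lia | by lia|].
apply: leq_trans (frp_fn5 x2 rx dx) _.
by apply: leq_fn => //; lia.
Qed.

(** * The multiset recursion m^* *)

Section Multiset.
Local Open Scope mset_scope.

Lemma mset_min_le (tau : {mset nat}) j : j \in tau -> mset_min tau <= j.
Proof.
rewrite /mset_min => jt.
have : j \in sort leq tau by rewrite mem_sort.
have : sorted leq (sort leq tau) by apply: sort_sorted; exact: leq_total.
case: (sort leq tau) => //= k s ks; rewrite inE => /predU1P[->//|js].
exact: (allP (order_path_min leq_trans ks)).
Qed.

(* Removing the minimum k > 0 of tau trades one factor of level 8 + 2 k for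
   k * iter i g x factors of level 6 + 2 k; one level of difference absorbs
   their number, the other the increment of i. *)
Fixpoint mset_fgh (K : nat) (tau : {mset nat}) (y : nat) : nat :=
  if K is k.+1 then iter (tau k) (fn (8 + 2 * k)) (mset_fgh k tau y) else y.

Lemma mset_fgh_low K (tau : {mset nat}) y :
  (forall j, j < K -> tau j = 0) -> mset_fgh K tau y = y.
Proof.
by elim: K => //= k IH tau0; rewrite tau0 //= IH // => j jk; apply: tau0; lia.
Qed.

Lemma mset_fgh_le K k (tau tau' : {mset nat}) y y' : k <= K ->
  (forall j, k <= j < K -> tau' j = tau j) ->
  mset_fgh k tau' y' <= mset_fgh k tau y -> mset_fgh K tau' y' <= mset_fgh K tau y.
Proof.
move=> /subnK <-; elim: (K - k) => // i IH tt' le; rewrite addSn /=.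
rewrite tt' ?leq_addl ?addSn ?leqnn //; apply: leq_iter_fgh; apply: IH => // j /andP[kj ji].
by apply: tt'; lia.
Qed.

Variables (g : nat -> nat) (x Y : nat).
Hypothesis Y2 : 2 < Y.
Hypothesis gY : forall t y, Y <= y -> t <= y -> g t <= fn 7 y.

Let E i := iter i g x + 1.

(** Here y bounds [iter i g x], and F_7 y is the bound that [gY] gives for the next iterate. *)
Lemma mset_fgh_step K i y (tau : {mset nat}) : K <= Y -> tau != mset0 ->
    (forall j, j \in tau -> j <= K) -> Y <= y -> iter i g x <= y ->
  mset_fgh K.+1 (tau_sub (mset_min tau) i E tau) (fn 7 y) <= mset_fgh K.+1 tau y.
Proof.
move=> KY tau0 tauK Yy iy; have := mset_minP tau0.
have low j : j < mset_min tau -> tau j = 0.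
  by move=> jm; apply/mset_eq0P/negP => /mset_min_le; rewrite leqNgt jm.
move: (mset_min tau) low => k low kt; rewrite in_mset in kt.
have kK : k <= K by apply: tauK; rewrite in_mset.
rewrite /tau_sub; case: ifP => k0; last first.
  (* Removing a copy of 0 frees one F_8, which pays for F_7. *)
  have {k0 low} k0 : k = 0 by lia.
  apply: (@mset_fgh_le _ 1) => // [j jK|].
    by rewrite k0 msetB1E; case: eqP => [|_]; rewrite ?subn0 //; lia.
  rewrite k0 in kt *; rewrite /= msetB1E eqxx /= -[tau 0 in leqRHS](subnK kt) addn1 iterSr.
  by apply: leq_iter_fgh; apply: leq_fn => //; lia.
case: k k0 low kt kK => // k _ low kt kK; rewrite /E addnK.
apply: (@mset_fgh_le _ k.+2) => // [j jK|].
  rewrite msetE2 msetB1E msetnE; do 2!(case: eqP => ?; first by lia).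
  by rewrite subn0 addn0.
rewrite [leqLHS]/= [leqRHS]/= !(msetE2, msetB1E, msetnE).
rewrite !eqxx; have -> : (k.+1 == k) = false by lia.
have -> : (k == k.+1) = false by lia.
rewrite [mset_fgh k tau y]mset_fgh_low; last by move=> j jk; apply: low; lia.
rewrite mset_fgh_low; last first.
  move=> j jk; rewrite msetE2 msetB1E msetnE; do 2!(case: eqP => ?; first by lia).
  by rewrite low //; lia.
rewrite (low k) // sub0n add0n.
rewrite addn0 -[tau k.+1 in leqRHS](subnK kt) addn1 iterSr.
apply: leq_iter_fgh.
have -> : 8 + 2 * k.+1 = (9 + 2 * k).+1 by lia.
have y1 : 1 < y by apply: leq_trans Yy; exact: ltnW.
have y0 := ltnW y1.
apply: leq_trans (fn_fn (9 + 2 * k) y1).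
have le97 : fn 7 y <= fn (9 + 2 * k) y by apply: leq_fn => //; lia.
apply: leq_trans (fn_mono _ le97); rewrite -[9 + _]/(8 + 2 * k).+1.
(* There are at most y * y new factors, and y * y <= F_2 y <= F_7 y. *)
apply: iter_fn; apply: (@leq_trans (fn 2 y)); last exact: leq_fn.
by apply: leq_trans (fn2_ge_sqr y); apply: leq_mul => //; lia.
Qed.

Lemma tau_sub_le k i F K (tau : {mset nat}) : k <= K ->
  (forall j, j \in tau -> j <= K) -> forall j, j \in tau_sub k i F tau -> j <= K.
Proof.
move=> kK tauK j; rewrite /tau_sub; case: ifP => k0.
  by rewrite in_msetD in_msetn in_msetB1 => /orP[/andP[_ /tauK //]|/andP[_ /eqP ->]]; lia.
by rewrite in_msetB1 => /andP[_ /tauK].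
Qed.

(** The induction carries the iterate at the final time [frm E tau i + i], which is invariant: each
    step takes one from the first summand and adds one to i. *)
Lemma iter_frm_le K i y (tau : {mset nat}) : K <= Y ->
    (forall j, j \in tau -> j <= K) -> Y <= y -> iter i g x <= y ->
  iter (frm E tau i + i) g x <= mset_fgh K.+1 tau y.
Proof.
move=> KY; elim/(well_founded_ind tau_wf): tau i y => tau IH i y tauK Yy iy.
rewrite frmE; have [->|tau0] := eqVneq tau mset0.
  by rewrite mset_fgh_low // => j _; exact: mset0E.
apply: leq_trans (mset_fgh_step KY tau0 tauK Yy iy).
rewrite add1n addSnnS; apply: IH.
- exact: tau_step_sub.
- by apply: tau_sub_le => //; apply: tauK; exact: mset_minP.
- by apply: leq_trans Yy _; exact/ltnW/fn_gt.
- exact: gY.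
Qed.

End Multiset.

(** The singleton {x} gives one factor of level 2 * x + 8; the 1 added in [mstar] is one more
    application of g, covered by the next level. *)
Lemma fru_le c x y : 2 < y -> c <= y -> x <= y ->
  fru (Fchar c) x <= fn (2 * x + 9) y.
Proof.
move=> y2 cy xy; rewrite /fru /mstar addn1 iterS.
set g := Fsub (Fchar c) x.
have gY t z : y <= z -> t <= z -> g t <= fn 7 z.
  by move=> yz tz; apply: Fsub_le; lia.
apply: leq_trans (gY _ (fn (2 * x + 8) y) _ _) _; first exact/ltnW/fn_gt.
  have := @iter_frm_le g x y y2 gY x 0 y [mset x]%mset xy.
  rewrite addn0 => /(_ _ _ _)/leq_trans; apply=> //.
    by move=> j; rewrite in_mset1 => /eqP->.
  rewrite /= mset_fgh_low ?msetnxx ?[8 + _]addnC // => j jx.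
  by rewrite msetnE; case: eqP => // ?; lia.
have -> : 2 * x + 9 = (2 * x + 8).+1 by lia.
apply: leq_trans (fn_fn _ (ltnW y2)).
by apply: leq_fn; [exact: leq_ltn_trans (fn_gt _ _) | lia].
Qed.

(** * F_omega and one step of D^char *)

Definition fw : nat -> nat := fgh omega.

Lemma fwE x : fw x = iter x (fn x) x.+1.
Proof.
rewrite /fw /omega fghE // fs_opow; last exact: ofin_neq0.
by rewrite fs_ofinS /fn (ofinE x).
Qed.

Lemma fw_gt x : x < fw x. Proof. exact: fgh_gt. Qed.

Lemma fw_mono x y : x <= y -> fw x <= fw y. Proof. exact: fgh_mono. Qed.

Lemma fn_fw k x y : 0 < x -> k <= x -> x <= y -> fn k x <= fw y.
Proof.
move=> x0 kx xy; apply: leq_trans (fw_mono xy); rewrite fwE.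
apply: leq_trans (leq_iter_count _ _ x0).
by apply: leq_trans (leq_fn x0 kx) _; exact: fn_mono.
Qed.

Lemma fw_ge x : 2 < x -> 2 * x + 9 <= fw x.
Proof.
move=> x2; apply: leq_trans (@fn_fw 2 x x _ _ _); try lia.
rewrite fn2; have : 8 <= 2 ^ x by rewrite (@leq_exp2l 2 3).
nia.
Qed.

(** The inner F_omega lifts the argument to the level k at least; the outer one then dominates F_k
    by diagonalization. *)
Lemma fn_fw2 k x : 2 < x -> k <= 2 * x + 9 -> fn k x <= fw (fw x).
Proof.
move=> x2 kx; have x0 : 0 < x by lia.
have h := fw_ge x2.
apply: leq_trans (fn_mono k (ltnW (fw_gt x))) _.
by apply: fn_fw => //; lia.
Qed.

Lemma iter_fw_ge k x : k + x <= iter k fw x.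
Proof. exact: iter_fgh_ge. Qed.

Lemma fru_plus_le c x : 2 < x -> c <= x -> fru_plus (Fchar c) c <= fw (fw x).
Proof.
move=> x2 cx; rewrite /fru_plus geq_max; apply/andP; split.
  by apply: leq_trans (fru_le x2 cx cx) _; apply: fn_fw2 => //; lia.
apply: (@leq_trans (fn 4 x)); last by apply: fn_fw2 => //; lia.
by apply: leq_trans (ltnW (e2_fn4 x2)); rewrite /frd; e2_bound.
Qed.

(** The six applications come in pairs: two bound U, two bound u_F(U), two bound p_U of it. The
    other terms of the maximum are elementary in the value after the first pair. *)
Lemma Dchar_step n m b i x : 2 < x -> n <= x -> m <= x -> Dchar n m b i <= x ->
  Dchar n m b i.+1 <= iter 6 fw x.
Proof.
move=> x2 nx mx; rewrite [Dchar _ _ _ i.+1]/=; move: (Dchar _ _ _ _) => c cx.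
have := fru_plus_le x2 cx; rewrite /frf; move: (fru_plus _ _) => U.
have := iter_fw_ge 2 x; rewrite -[iter 6 _ _]/(iter 4 fw (iter 2 fw x)).
rewrite -[fw (fw x)]/(iter 2 fw x); move: (iter 2 fw x) => y xy Uy.
have y2 : 2 < y by lia.
have cy : c <= y by lia.
have fw4 a : a <= e2 30 y -> a <= iter 4 fw y.
  move=> ay; apply: leq_trans ay _; apply: leq_trans (ltnW (e2_fn4 y2)) _.
  apply: (@leq_trans (fw (fw y))); first by apply: fn_fw2 => //; lia.
  exact: (@leq_iter_count _ 2 4).
rewrite !geq_max; apply/and3P; split.
- by apply: fw4; rewrite /frg; e2_bound.
- have fruU : fru (Fchar c) U <= fw (fw y).
    by apply: leq_trans (fru_le y2 cy Uy) _; apply: fn_fw2 => //; lia.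
  have := iter_fw_ge 2 y; rewrite -[iter 4 fw y]/(fw (fw (iter 2 fw y))).
  rewrite -[fw (fw y)]/(iter 2 fw y) in fruU *; move: (iter 2 fw y) fruU => t Ut yt.
  have t2 : 2 < t by lia.
  apply: leq_trans (frp_fn5 t2 _ Ut) _; first lia.
  by apply: fn_fw2 => //; lia.
- by apply: fw4; rewrite /frd; e2_bound.
Qed.

Definition omega_add (k : nat) : ord := Cons (ofin 1) 0 (ofin k).

Lemma fgh_omega_addS k x :
  fgh (omega_add k.+1) x = iter x (fgh (omega_add k)) x.+1.
Proof.
by rewrite fghE // /omega_add fs_ctx ?fs_ofinS //; exact: ofin_neq0.
Qed.

Lemma iter_omega_add k j x : j <= x ->
  iter j (fgh (omega_add k)) x <= fgh (omega_add k.+1) x.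
Proof.
move=> jx; rewrite fgh_omega_addS; apply: leq_trans (leq_iter_count _ _ jx) _.
exact: leq_iter_fgh.
Qed.

(** The form 3 * (x + v) + 4 anticipates [cover_vec_le] for a cover of size at most x + v and e = 4.
    Eight iterations of F_omega fit in: six for v, two for the arithmetic. *)
Lemma fgh_omega2_gt x v : 2 < x -> v <= iter 6 fw x ->
  3 * (x + v) + 4 < fgh (omega_add 2) x.
Proof.
move=> x2 vx; have := @iter_omega_add 1 2 x (ltnW x2); apply: leq_trans => /=.
set y := fgh (omega_add 1) x.
have y8 : 8 <= y.
  apply: leq_trans (@iter_omega_add 0 1 x (ltnW (ltnW x2))).
  by apply: (@leq_trans (fw x)) => //; apply: leq_trans (fw_ge x2); lia.
apply: leq_trans (iter_omega_add 0 y8); rewrite -/fw.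
have xy : x <= y by exact/ltnW/fgh_gt.
apply: (@leq_trans (iter 8 fw x)); last exact: leq_iter_fgh.
rewrite -[8]/(2 + 6) iterD; have := iter_fw_ge 6 x.
move: (iter 6 fw x) vx => t vt xt.
have t2 : 2 < t by lia.
apply: (@leq_trans (fn 4 t)); last by apply: fn_fw2 => //; lia.
by apply: leq_ltn_trans (e2_fn4 t2); e2_bound.
Qed.

Lemma Dchar_growth n m b i x : 2 < x -> n <= x -> m <= x -> Dchar n m b i <= x ->
  3 * (x + Dchar n m b i.+1) + 4 < fgh (omega_add 2) x.
Proof. by move=> x2 nx mx ix; apply: fgh_omega2_gt => //; exact: Dchar_step. Qed.

(** * Covers of the admissible derivatives *)

Section Boxes.
Variables n m : nat.
Implicit Types (u v x : deriv n m) (s : seq (deriv n m)).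

(* [Some c] fixes an exponent to be c, [None] leaves it free. *)
Definition box := ({ffun 'I_m -> option nat} * 'I_n)%type.
Implicit Types (B : box) (cs : seq box).

Definition inbox B u : bool :=
  (B.2 == u.2) && [forall i, if B.1 i is Some c then c == tnth u.1 i else true].

Definition bdim B : nat := #|[pred i | B.1 i == None]|.

Definition bfix B (i : 'I_m) (c : nat) : box :=
  ([ffun j => if j == i then Some c else B.1 j], B.2).

Definition refine B x : seq box :=
  [seq bfix B i c | i <- [seq i <- enum 'I_m | B.1 i == None], c <- iota 0 (tnth x.1 i)].

Lemma bdim_le B : bdim B <= m.
Proof. by apply: leq_trans (max_card _) _; rewrite card_ord. Qed.

(** Inside B, x and u agree in the fixed coordinates, so a coordinate where u is smaller than x is
    free, and fixing it at the exponent of u captures u. *)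
Lemma refine_in B x u : inbox B x -> inbox B u -> ~~ divides x u ->
  has (inbox^~ u) (refine B x).
Proof.
move=> /andP[/eqP Bx /forallP fx] /andP[/eqP Bu /forallP fu].
rewrite /divides -Bx -Bu eqxx /= negb_forall => /existsP[i]; rewrite -ltnNge => ui.
have Bi : B.1 i == None.
  move: (fx i) (fu i); case: (B.1 i) => // c /eqP cx /eqP cu.
  by rewrite -cx -cu ltnn in ui.
apply/hasP; exists (bfix B i (tnth u.1 i)).
  by apply/allpairsPdep; exists i, (tnth u.1 i); rewrite mem_filter Bi mem_enum mem_iota.
rewrite /inbox /= Bu eqxx; apply/forallP => j; rewrite ffunE.
by have [->|_] := eqVneq j i; [exact: eqxx | exact: fu].
Qed.

Lemma refine_dim B x B' : B' \in refine B x -> bdim B = (bdim B').+1.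
Proof.
case/allpairsPdep=> i [c [+ _ ->]]; rewrite mem_filter => /andP[Bi _].
rewrite /bdim (cardD1 i) inE Bi add1n; congr _.+1; apply: eq_card => j.
by rewrite !inE ffunE; case: eqVneq.
Qed.

Lemma size_refine B x : size (refine B x) <= sumn x.1.
Proof.
rewrite size_allpairs_dep !sumnE big_map big_filter big_tuple big_enum_cond /=.
rewrite big_mkcond; apply: leq_sum => i _; rewrite size_iota.
by case: ifP.
Qed.

Definition covers cs s : Prop :=
  forall u, all (fun v => ~~ divides v u) s -> has (inbox^~ u) cs.

Lemma covers_rcons cs s x : covers cs s -> all (fun v => ~~ divides v x) s ->
  exists B cs', perm_eq cs (B :: cs') /\ covers (refine B x ++ cs') (rcons s x).
Proof.
move=> css sx; have /hasP[B Bcs Bx] := css x sx.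
exists B, (rem B cs); split; first exact: perm_to_rem.
move=> u; rewrite all_rcons => /andP[xu su]; rewrite has_cat.
have := css u su; rewrite (perm_has _ (perm_to_rem Bcs)) /= => /orP[Bu|->].
  by rewrite refine_in.
by rewrite orbT.
Qed.

Definition dim_count cs (j : nat) : nat := count (fun B => bdim B == j) cs.

(* Adding omega + e keeps the hierarchy above the growth of D; points weigh 3
   so that removing one pays for raising e from 2 to 4. *)
Definition cover_vec cs (e j : nat) : nat :=
  if j == 0 then 3 * dim_count cs 0 + e else dim_count cs j + (j == 1).

Lemma dim_count_refine B x j :
  dim_count (refine B x) j = if j.+1 == bdim B then size (refine B x) else 0.
Proof.
rewrite /dim_count; case: eqP => [jB|/eqP jB].
  rewrite (eq_in_count (a2 := predT)) ?count_predT // => B' /refine_dim B'B.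
  by rewrite -eqSS jB B'B eqxx.
apply/eqP; rewrite -leqn0 leqNgt -has_count; apply/hasPn => B' /refine_dim B'B.
by rewrite -eqSS -B'B eq_sym.
Qed.

Lemma cover_vec_above cs cs' B x e e' j : perm_eq cs (B :: cs') -> bdim B < j ->
  cover_vec (refine B x ++ cs') e' j = cover_vec cs e j.
Proof.
move=> pcs Bj; rewrite /cover_vec; case: eqP Bj => [->//|_] Bj.
rewrite /dim_count count_cat (permP pcs) -!/(dim_count _ _) dim_count_refine /=.
by rewrite (ltn_eqF Bj) ifN // gtn_eqF // ltnS ltnW.
Qed.

Lemma cover_vec_at cs cs' B x : perm_eq cs (B :: cs') ->
  cover_vec (refine B x ++ cs') 4 (bdim B) < cover_vec cs 2 (bdim B).
Proof.
move=> pcs; rewrite /cover_vec /dim_count !count_cat !(permP pcs) -!/(dim_count _ _).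
(* For a point box, 3 * c + 4 < 3 * (c + 1) + 2. *)
rewrite !dim_count_refine /=; case: eqP => [->|_]; first by rewrite /=; lia.
by rewrite eqxx gtn_eqF.
Qed.

Lemma cover_vec_le cs e j : 0 < e -> cover_vec cs e j <= 3 * size cs + e.
Proof.
move=> e0.
have dimc i : dim_count cs i <= size cs by exact: count_size.
by rewrite /cover_vec; have := dimc 0; have := dimc j; case: ifP => _; lia.
Qed.

Definition full_cover : seq box := [seq ([ffun=> None], r) | r <- enum 'I_n].

Lemma covers_full : covers full_cover [::].
Proof.
move=> u _; apply/hasP; exists ([ffun=> None], u.2); first by rewrite map_f ?mem_enum.
by rewrite /inbox eqxx; apply/forallP => i; rewrite ffunE.
Qed.

Lemma size_full : size full_cover = n.
Proof. by rewrite size_map size_enum_ord. Qed.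

Lemma dim_count_full j : dim_count full_cover j = if j == m then n else 0.
Proof.
have dimB B : B \in full_cover -> bdim B = m.
  case/mapP=> r _ ->; rewrite /bdim -[RHS]card_ord; apply: eq_card => i.
  by rewrite !inE ffunE.
rewrite /dim_count (eq_in_count (a2 := fun=> m == j)); last first.
  by move=> B /dimB ->.
rewrite eq_sym; case: eqP => _; first by rewrite count_predT size_full.
exact: count_pred0.
Qed.

End Boxes.

(** * The nested loops of h *)

Lemma vloop_le (D H : nat -> nat) f x : (forall t, t <= H t) ->
    (forall k v t, x <= t -> D v <= t -> D (v + f k v) <= H t) ->
  forall K v t, x <= t -> D v <= t -> D (vloop f K v) <= iter K H t.
Proof.
move=> Hge fH; elim=> [//|K IH] v t xt vt; rewrite iterSr /=; apply: IH.
  exact: leq_trans xt (Hge t).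
exact: fH.
Qed.

Lemma wloop_le (D G : nat -> nat) step x U : (forall t, t <= G t) ->
    (forall u v t, u <= U -> x <= t -> D v <= t -> D (step u v) <= G t) ->
  forall v t, x <= t -> D v <= t -> D (wloop step U v) <= iter U.+1 G t.
Proof.
move=> Gge; elim: U => [|U IH] stG v t xt vt; first exact: stG.
rewrite iterSr /=; apply: IH; last exact: stG.
  by move=> u w r uU; apply: stG; exact: ltnW.
exact: leq_trans xt (Gge t).
Qed.

Lemma Z_order n m u x : Z n m u = Some x -> sumn x.1 < u.
Proof.
case: u => //= u; rewrite onthE => ux.
suff : x \in derivs_upto n m u by rewrite mem_derivs_upto.
have [uP|uP] := ltnP u (size (derivs_upto n m u)); last first.
  by rewrite nth_default ?size_map // in ux.
by move: ux; rewrite (nth_map x) // => -[<-]; exact: mem_nth.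
Qed.

Definition omega_vec (k j : nat) : nat := if j == 0 then k else (j == 1).

Lemma ovec_omega d k : ovec d.+2 (omega_vec k) = omega_add k.
Proof.
elim: d => [|d IH]; last by rewrite -IH.
by rewrite /omega_add /= -ofinE.
Qed.

Section Growth.
Variables n m Y : nat.
Hypothesis m0 : 0 < m.
Hypothesis Y2 : 2 < Y.

(** What the bound on h uses of D^char; quantifying over i makes it stable under [shift]. *)
Definition growth (D : nat -> nat) : Prop := forall i x, Y <= x -> D i <= x ->
  3 * (x + D i.+1) + 4 < fgh (omega_add 2) x.

Lemma growth_shift D v : growth D -> growth (shift D v).
Proof. by move=> gD i x Yx; rewrite /shift (addnS v); exact: gD. Qed.

Local Notation alpha cs e := (ovec m.+1 (cover_vec cs e)).

Lemma iter_cover (cs : seq (box n m)) e t :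
  iter t (fgh (alpha cs e)) t.+1 <= fgh (alpha cs e.+1) t.
Proof.
apply: (@fgh_lex _ 0) => // [j /andP[j0 _]|]; first by rewrite /cover_vec gtn_eqF.
by rewrite /cover_vec /=; lia.
Qed.

Lemma fgh_omega2_cover (cs : seq (box n m)) e x : 1 < e -> Y <= x ->
  fgh (omega_add 2) x <= fgh (alpha cs e) x.
Proof.
move=> e1 Yx; case: m m0 cs => // d _ cs; rewrite -(ovec_omega d).
have x2 := leq_trans Y2 Yx.
apply: (@fgh_reach x) => //; first by lia.
apply: reach_ovec => j _; rewrite /omega_vec /cover_vec; case: eqP => _; lia.
Qed.

(** Three values of e share the work. The loop over k raises the refined cover from e = 3, given by
    the recursive calls, to e = 4; refinement places this below the old cover with e = 2; the loop
    over u raises that to e = 3. *)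
Lemma frh_seq_le (ga : seq (deriv n m * nat)) (cs : seq (box n m)) D y :
    growth D -> covers cs (leaders ga) -> Y <= y -> size cs <= y -> D 0 <= y ->
  D (frh_seq D ga) <= fgh (alpha cs 3) y.
Proof.
elim/(well_founded_ind (@hext_wf n m)): ga cs D y => ga IH cs D y gD cov Yy csy D0.
have D1 := gD 0 y Yy D0.
have y2 : 2 < y by exact: leq_trans Yy.
rewrite frh_seqE; case: ifP => _.
  apply: leq_trans (fgh_omega2_cover cs (isT : 1 < 3) Yy); lia.
set x := fgh (omega_add 2) y in D1.
have xy : y < x by exact: fgh_gt.
have Dx : D 1 <= x by lia.
pose al := alpha cs 2.
have al0 : al <> Zero by by apply: (@ovec_neq0 _ _ 0) => //; rewrite /cover_vec addn2.
(* The index is frozen at x = F_(omega + 2) y, which exceeds both the number of rounds and the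
   coefficients of the refined covers, so one G serves for every u. *)
pose G := fgh (fs al x).
apply: (@leq_trans (iter (D 1).+1 G x)); last first.
  apply: (@leq_trans (fgh al (fgh al y))).
    apply: leq_trans (fgh_mono al (fgh_omega2_cover cs (isT : 1 < 2) Yy)).
    rewrite -/x [leqRHS]fghE //.
    have Dx1 : (D 1).+1 <= x by lia.
    apply: leq_trans (leq_iter_count _ _ Dx1) _; exact: leq_iter_fgh.
  apply: (@leq_trans (iter y (fgh al) y.+1)).
    apply: leq_trans (leq_iter_fgh _ _ (leqnSn y)).
    exact: (@leq_iter_count al 2 y y (ltnW y2)).
  exact: iter_cover.
apply: wloop_le (leqnn x) Dx => [t|u w t uD xt wt]; first exact/ltnW/fgh_gt.
have tG : t <= G t by exact/ltnW/fgh_gt.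
case Zu: Z => [d|]; last exact: leq_trans tG.
case: ifP => [bad|_]; last exact: leq_trans tG.
have nd : all (fun v => ~~ divides v d) (leaders ga).
  by have /andP[_] := bad; rewrite -cats1 pairwise_cat allrel1r => /and3P[].
have [B [cs' [pcs cov']]] := covers_rcons cov nd.
have size_cs' : size (refine B d ++ cs') <= y + D 1.
  have /= szcs := perm_size pcs.
  (* Z_u has order below u, and u <= D 1, which bounds the number of new boxes. *)
  have du := leq_trans (size_refine B d) (ltnW (leq_trans (Z_order Zu) uD)).
  rewrite size_cat addnC; apply: leq_add du; apply: leq_trans csy.
  by rewrite szcs.
have t2 : 2 < t by lia.
apply: (@leq_trans (fgh (alpha (refine B d ++ cs') 4) t)); last first.
  apply: (@fgh_reach x) => //; first by lia.
  apply: (@reach_fs_ovec _ (bdim B)).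
  - exact: bdim_le.
  - by move=> j /andP[Bj _]; exact: cover_vec_above.
  - exact: cover_vec_at.
  - move=> j _; apply: leq_ltn_trans (cover_vec_le _ _ _) _ => //; lia.
apply: (@leq_trans (iter t (fgh (alpha (refine B d ++ cs') 3)) t.+1)); last first.
  exact: iter_cover.
apply: leq_trans (leq_iter_fgh _ _ (leqnSn t)).
apply: leq_trans (leq_iter_count _ _ wt).
apply: vloop_le (xt) wt => [r|k v r xr vr]; first exact/ltnW/fgh_gt.
rewrite -[D _]/(shift D v (frh_seq _ _)); apply: IH.
- exact: hextI.
- exact: growth_shift.
- by rewrite /leaders map_rcons.
- by lia.
- by lia.
- by rewrite /shift addn0.
Qed.

End Growth.

Lemma ichar_le n m b : 0 < m -> 2 < b -> n <= b -> m <= b ->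
  ichar n m b <= fgh (ovec m.+1 (cover_vec (full_cover n m) 3)) b.
Proof.
move=> m0 b2 nb mb; rewrite /ichar /frh; apply: (@frh_seq_le _ _ b) => //.
- move=> i x bx ix.
  by apply: Dchar_growth => //; exact: leq_trans bx.
- exact: covers_full.
- by rewrite size_full.
Qed.

(** * Normal form of the bounding ordinal and conclusion *)

Lemma eq_ovec d a a' : (forall j, j < d -> a j = a' j) -> ovec d a = ovec d a'.
Proof.
elim: d => //= d IH aa'; rewrite aa' // IH // => j jd; apply: aa'; exact: ltnW.
Qed.

(** Coefficients of omega^m * 2n + omega; for m = 1 both terms fall on the same power. *)
Definition bound_vec (n m j : nat) : nat :=
  if j == m then 2 * n + (m == 1) else (j == 1).

Lemma ocmp_ofin i j : j < i -> ocmp (ofin i) (ofin j) = Gt.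
Proof.
case: i => // i; case: j => [|j] ji; rewrite !ofinE //=.
by rewrite ltnNge -ltnS ltnW //= -ltnS ji.
Qed.

Lemma ovec_boundSS n d :
  ovec d.+3 (bound_vec n d.+2) = cons_term (ofin d.+2) (2 * n) omega.
Proof.
rewrite [LHS]/(cons_term (ofin d.+2) _ (ovec d.+2 _)) {1}/bound_vec eqxx addn0.
congr cons_term; transitivity (ovec d.+2 (omega_vec 0)); last by rewrite ovec_omega.
apply: eq_ovec => j jd; rewrite /bound_vec /omega_vec ltn_eqF //.
by case: j jd => [|[]].
Qed.

Lemma ovec_bound n m : 0 < n -> 0 < m ->
  oadd (omuln (opow (ofin m)) (2 * n)) omega = ovec m.+1 (bound_vec n m).
Proof.
move=> n0; have [p np] : exists p, 2 * n = p.+1 by exists (2 * n).-1; lia.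
case: m => [//|[|d]] _; rewrite omuln_opow np.
  by rewrite /= /bound_vec /= np addn0.
rewrite ovec_boundSS np.
have := ocmp_ofin (isT : 1 < d.+2); move: (ofin d.+2) => e /= eg.
by rewrite eg.
Qed.

Lemma hardy_Cons_ge a e c r b : a <= hardy r b -> c.+1 + a <= hardy (Cons e c r) b.
Proof.
move=> ar; rewrite hardy_Cons (hardy_coef e c.+1).
by apply: leq_trans (iter_fgh_ge _ _ _); rewrite leq_add2l.
Qed.

(** Puts X above the exponents omega + 1, omega, 2 and 1, in the form in which [oadd] evaluates the
    comparisons. *)
Definition exceeds_omega (X : ord) : Prop :=
  (forall r, ocmp X (Cons (ofin 1) 0 r) = Gt) /\
  (forall c, ocmp X (Cons Zero c Zero) = Gt).

Lemma exceeds_omega_cons m k r : 0 < m -> 0 < k -> exceeds_omega (Cons (ofin m) k r).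
Proof.
case: m => // m _ k0; split=> [r'|c]; last by rewrite ofinE.
case: m => [|m]; first by rewrite /= k0.
by have := ocmp_ofin (isT : 1 < m.+2); move: (ofin m.+2) => e /= ->.
Qed.

Lemma bound_ordE n m : 0 < n -> 0 < m -> exists r,
  bound_ord n m = Cons (ovec m.+1 (bound_vec n m)) 0 r /\
  forall b, b + 4 <= hardy r b.
Proof.
move=> n0 m0; rewrite /bound_ord ovec_bound //.
have [k nk k0] : exists2 k, 2 * n = k.+1 & 0 < k by exists (2 * n).-1; lia.
have X0P : exceeds_omega (ovec m.+1 (bound_vec n m)).
  rewrite /= {1}/bound_vec eqxx nk /=; apply: exceeds_omega_cons => //.
  exact: leq_trans (leq_addr _ _).
set X1 := oadd _ (ofin 1).
have X1E : X1 = Cons (ofin m) k (ofin 1).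
  by rewrite /X1 omuln_opow nk; case: (m) m0 => // m' _; rewrite ofinE.
have X1P : exceeds_omega X1 by rewrite X1E; exact: exceeds_omega_cons.
have X01 : ocmp (ovec m.+1 (bound_vec n m)) X1 = Gt.
  rewrite X1E; case: (m) m0 => [//|[|d]] _.
    by rewrite /= /bound_vec /= nk /= addn1 ltnNge leqnSn ltnSn.
  have gt e : ocmp (Cons e k omega) (Cons e k (ofin 1)) = Gt.
    by rewrite /= ocmp_refl ltnn.
  by rewrite ovec_boundSS nk; exact: gt.
move: (ovec _ _) X1 X0P X1P X01 {X1E} => X0 X1 [X0o X0f] [X1o X1f] X01.
exists (Cons X1 0 (Cons (omega_add 1) 0
  (Cons omega 1 (Cons (ofin 2) 0 (Cons (ofin 1) 1 Zero))))).
split=> [|b].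
  rewrite !omuln_opow /= in X0o X1o *.
  by do 6 rewrite ?(X01, X0o, X0f, X1o, X1f) /=.
have b0 : b <= hardy Zero b by rewrite ord_iterE.
(* The five terms have coefficients 1, 1, 2, 1, 2 and add at least 7 to the argument. *)
apply: leq_trans; last by do 5 apply: hardy_Cons_ge; exact: b0.
by lia.
Qed.

Theorem lemma7p21 (n m b : nat) (hn : 1 <= n) (hm : 1 <= m)
    (hb : maxn 3 (maxn m n) <= b) :
  ichar n m b <= ord_iter calG (bound_ord n m) b.
Proof.
move: hb; rewrite !geq_max => /and3P[b3 mb nb].
have [r [-> rb]] := bound_ordE hn hm.
rewrite hardy_Cons; move: (hardy r b) (rb b) => y yb.
apply: leq_trans (ichar_le hm b3 nb mb) _.
apply: (@leq_trans (fgh (ovec m.+1 (cover_vec (full_cover n m) 3)) y)).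
  by apply: fgh_mono; lia.
(* At omega^m the coefficients compare as n < 2 * n, both raised by 1 when m = 1; the lower ones of
   the cover are at most 3, hence below y. *)
apply: (@fgh_lex1 _ m) => //; first by lia.
- by move=> j /andP[mj jm]; lia.
- by rewrite /cover_vec gtn_eqF // dim_count_full /bound_vec !eqxx; lia.
- move=> j jm; rewrite /cover_vec !dim_count_full (ltn_eqF jm) (ltn_eqF hm).
  by case: eqP => _; lia.
Qed.
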